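(* Let $\mathcal P$ be an infinite unimodular random rooted ideal hyperbolic polyhedron with root face $f_\rho$. Then $$\mathbb{E}[T_{\mathcal P}(f_\rho)]=\mathbb{E}[\kappa_{\mathcal P}(f_\rho)],$$ where $T_{\mathcal P}(f)=2\pi-\sum_{e\in\partial f}\Theta_{\mathcal P}(e)$ and $\kappa_{\mathcal P}(f)=2\pi-\sum_{v\in\partial f}\frac{(\deg(v)-2)\pi}{\deg(v)}$ for a face $f$ of $\mathcal P$. Moreover both expectations are finite if in addition $\mathbb{E}[\deg(f_\rho)]<\infty$.
   Context: An infinite ideal hyperbolic polyhedron (IHP) is the convex hull in $\mathbb{H}^3$ of a countably infinite collection of isolated points (ideal vertices) of the sphere at infinity. $\Theta_{\mathcal P}(e)\in(0,\pi)$ is the dihedral angle of $\mathcal P$ along the edge $e$; sums run over the boundary edges, resp. the ideal vertices, of the face $f$; $\deg(v)$ is the number of faces (equivalently edges) of $\mathcal P$ meeting at the ideal vertex $v$ and $\deg(f)$ the number of edges of the face $f$. The dual $1$-skeleton $P_1^*$ has one vertex for each face of $\mathcal P$, two being adjacent when the faces share an edge; it is weighted by the dihedral angles and rooted at the vertex $\rho$ corresponding to $f_\rho$. Throughout, infinite IHP correspond to ideal angled graphs: $(P_1^*,\Theta_{\mathcal P})$ is the graph $(V,E)$ of an infinite, locally finite cellular decomposition of an open disk (faces of the decomposition correspond to ideal vertices of $\mathcal P$; the graph is simple, connected, one-ended, and each face of the decomposition is a finite polygon bounded by a simple cycle) such that $(C_1)$ $\sum_{e\in\partial f'}(\pi-\Theta(e))=2\pi$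 for every face $f'$ of the decomposition, and $(C_2)$ $\sum_{e\in\gamma}(\pi-\Theta(e))>2\pi$ for every closed cycle $\gamma$ of edges not bounding a face. $\mathcal P$ is called unimodular if the rooted weighted graph $(P_1^*,\rho,\Theta_{\mathcal P})$ is unimodular: for every nonnegative Borel isomorphism-invariant function $F$ of such a structure with an ordered pair of distinguished vertices, $\mathbb{E}[\sum_v F(\rho,v)]=\mathbb{E}[\sum_v F(v,\rho)]$. *)

(* Defs.v *)
From HB Require Import structures.
From mathcomp Require Import all_boot all_order all_algebra.
From mathcomp Require Import finmap.
From mathcomp Require Import all_classical all_reals all_analysis measurable_realfun.

Set Implicit Arguments.
Unset Strict Implicit.
Unset Printing Implicit Defensive.

Import Order.TTheory GRing.Theory Num.Theory.
Import numFieldNormedType.Exports.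

Local Open Scope classical_set_scope.
Local Open Scope ring_scope.

(* Number of elements of a finite set (0 if the set is infinite). *)
Definition ncard (T : choiceType) (A : set T) : nat := #|` fset_set A|.


Section Decomposition.
Variables (T U : choiceType).
(* 1-skeleton: vertex set V, adjacency E. 2-cells: indexed by the set F, the
   2-cell f being attached along the cyclic sequence of vertices [bd f]. *)
Variables (V : set T) (E : rel T) (F : set U) (bd : U -> seq T).

(* With [2 < size c], no edge is traversed twice. *)
Definition simple_cycle (c : seq T) : Prop :=
  [/\ uniq c, (2 < size c)%N & cycle E c].

Definition cycle_edge (c : seq T) (x y : T) : bool :=
  [&& x \in c, y \in c & (y == next c x) || (x == next c y)].

(* y, x, z are consecutive on c, in one of the two directions *)
Definition cycle_corner (c : seq T) (x y z : T) : bool :=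
  (x \in c) &&
  ((y == prev c x) && (z == next c x) || (y == next c x) && (z == prev c x)).

(* c and c' are the same closed curve, up to base point and orientation *)
Definition same_cycle (c c' : seq T) : Prop :=
  exists k, c' = rot k c \/ c' = rot k (rev c).

Definition bounds_face (c : seq T) : Prop :=
  exists2 f, F f & same_cycle (bd f) c.

Definition link (x : T) : rel T :=
  fun y z => `[< exists2 f, F f & cycle_corner (bd f) x y z >].

(* Edge-path homotopy in the 2-complex; a walk is its sequence of vertices. *)
Inductive homotopic : seq T -> seq T -> Prop :=
| homotopic_refl p : homotopic p p
| homotopic_sym p q : homotopic p q -> homotopic q p
| homotopic_trans p q r : homotopic p q -> homotopic q r -> homotopic p r
| homotopic_spur p x y q : E x y ->
    homotopic (p ++ x :: q) (p ++ [:: x, y, x & q])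
| homotopic_face p x c q f k : F f -> rot k (bd f) = x :: c ->
    homotopic (p ++ x :: q) (p ++ x :: rcons c x ++ q).

(* the connected component of x in the graph minus K *)
Definition component_off (K : set T) (x : T) : set T :=
  [set y | exists p, [/\ path E x p, last x p = y
                       & forall z, z \in x :: p -> V z /\ ~ K z]].

Definition one_ended : Prop :=
  forall K : set T, finite_set K ->
    exists2 x, infinite_set (component_off K x) &
      forall y, infinite_set (component_off K y) -> component_off K x y.

(* The 2-complex is a connected, simply connected, non-compact surface without
   boundary, i.e. an open disk: every edge lies on exactly two 2-cells
   [decomp_edge], which together with [decomp_link] makes the link of every
   vertex a single cycle. *)
Record disk_decomposition : Prop := {
  decomp_vertex : forall x y, E x y -> V x /\ V y;
  decomp_irrefl : irreflexive E;
  decomp_sym : symmetric E;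
  decomp_infinite : infinite_set V;
  decomp_locally_finite : forall x, V x -> finite_set [set y | E x y];
  decomp_connected : forall x y, V x -> V y ->
    exists2 p, path E x p & last x p = y;
  decomp_one_ended : one_ended;
  decomp_face : forall f, F f -> simple_cycle (bd f);
  decomp_edge : forall x y, E x y ->
    exists f g, [/\ F f, F g, f <> g &
      forall h, F h -> (cycle_edge (bd h) x y <-> h = f \/ h = g)];
  decomp_link : forall x y z, E x y -> E x z ->
    exists2 p, path (link x) y p & last y p = z;
  decomp_simply_connected : forall x p, V x -> path E x p -> last x p = x ->
    homotopic (x :: p) [:: x]
}.

Variables (R : realType) (Theta : T -> T -> R).

Definition exterior_sum (c : seq T) : R :=
  \sum_(x <- c) (pi - Theta x (next c x)).

Record ideal_angled_graph : Prop := {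
  iag_decomposition : disk_decomposition;
  iag_angle : forall x y, E x y -> 0 < Theta x y < pi;
  iag_sym : forall x y, E x y -> Theta x y = Theta y x;
  iag_C1 : forall f, F f -> exterior_sum (bd f) = 2 * pi;
  iag_C2 : forall c, simple_cycle c -> ~ bounds_face c ->
    2 * pi < exterior_sum c
}.

End Decomposition.

(* Projective (Klein) model of H^3:
   H^3 is the open unit ball of R^3, the sphere at infinity is the unit
   sphere, and hyperbolic planes and convex hulls are the Euclidean ones. *)

Section Polyhedron.
Variable R : realType.

Local Notation point := 'rV[R]_3.

Definition dot (x y : point) : R := \sum_(i < 3) x 0 i * y 0 i.

Definition hyperbolic_space : set point := [set x | dot x x < 1].
Definition sphere_at_infinity : set point := [set x | dot x x = 1].

(* (n, d) stands for the half-space {x | n.x <= d} with outward normal n. *)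
Local Notation half_space := (point * R)%type.

(* The Minkowski form: normalising [lorentz N N = 1] singles out one
   representative of each half-space whose bounding plane meets H^3. *)
Definition lorentz (N M : half_space) : R := dot N.1 M.1 - N.2 * M.2.

(* Interior dihedral angle of the intersection of two half-spaces whose
   bounding planes intersect: for unit outward normals, <N, M> = - cos. *)
Definition dihedral (N M : half_space) : R := acos (- lorentz N M).

Section Hull.
Variable V : set point.

Definition hull : set point :=
  hyperbolic_space `&`
  smallest (@convex_set R (convex_lmodType point)) V.

Definition face_set (N : half_space) : set point :=
  hull `&` [set x | dot N.1 x = N.2].

(* A face is represented by its supporting half-space. *)
Definition faces : set half_space := [set N |
  [/\ lorentz N N = 1,
      hull `<=` [set x | dot N.1 x <= N.2] &
      exists x y z, [/\ face_set N x, face_set N y, face_set N z &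
                        \rank (col_mx (y - x) (z - x)) = 2%N]]].

Definition ideal_vertices (N : half_space) : set point :=
  V `&` [set v | dot N.1 v = N.2].

Definition share_edge : rel half_space := fun N M =>
  `[< [/\ faces N, faces M, N <> M &
          exists x y, [/\ x <> y, (face_set N `&` face_set M) x
                        & (face_set N `&` face_set M) y]] >].

Definition faces_at (v : point) : set half_space :=
  [set N | faces N /\ ideal_vertices N v].

End Hull.

(* An infinite ideal hyperbolic polyhedron, given by its ideal vertices; the
   polyhedron itself is [hull ihp_vertices]. The last field is the standing
   correspondence with ideal angled graphs: the dual 1-skeleton, weighted by the
   dihedral angles, is the graph of a disk decomposition whose 2-cells are
   indexed by the ideal vertices, the boundary of the cell of v running through
   the faces that meet at v. *)
Record ihp := IHP {
  ihp_vertices :> set point;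
  ihp_sphere : ihp_vertices `<=` sphere_at_infinity;
  ihp_countably_infinite : (ihp_vertices #= [set: nat])%card;
  ihp_isolated : ihp_vertices `<=` isolated ihp_vertices;
  ihp_dual_angled : exists bd : point -> seq half_space,
        (forall v N, ihp_vertices v ->
           (N \in bd v <-> faces_at ihp_vertices v N)) /\
        ideal_angled_graph (faces ihp_vertices) (share_edge ihp_vertices)
          ihp_vertices bd dihedral
}.

Definition deg_vertex (P : ihp) (v : point) : nat := ncard (faces_at P v).

Definition deg_face (P : ihp) (f : half_space) : nat :=
  ncard [set g | share_edge P f g].

Definition T_ihp (P : ihp) (f : half_space) : R :=
  2 * pi - \sum_(g \in [set g | share_edge P f g]) dihedral f g.

Definition kappa_ihp (P : ihp) (f : half_space) : R :=
  2 * pi - \sum_(v \in ideal_vertices P f)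
    (((deg_vertex P v)%:R - 2) * pi / (deg_vertex P v)%:R : R).

End Polyhedron.


Section Unimodular.
Variable R : realType.

(* Edge-weighted graphs with vertex set nat, with the Borel structure generated
   by the evaluations; weight 0 encodes a non-edge (dihedral angles are > 0).
   Isomorphism-invariant Borel functions of such labelled graphs are the Borel
   functions of isomorphism classes. *)
Definition cylinder : set (set (nat -> nat -> R)) :=
  [set A | exists i j B, measurable B /\ A = [set W | B (W i j)]].

Local Notation wgraph := (g_sigma_algebraType cylinder).

Definition relabel (s : nat -> nat) (W : wgraph) : wgraph :=
  fun i j => W (s i) (s j).

Definition iso_invariant (F : wgraph -> nat -> nat -> \bar R) : Prop :=
  forall (s : nat -> nat) (W : wgraph) (u v : nat), bijective s ->
    F (relabel s W) u v = F W (s u) (s v).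

Variables (d : measure_display) (Om : measurableType d).
Variable Pr : probability Om R.

(* [rih_label] enumerates the faces, i.e. the vertices of the dual 1-skeleton;
   [rih_root] is the label of the root face. *)
Record random_rooted_ihp := RandomRootedIHP {
  rih_poly : Om -> ihp R;
  rih_label : Om -> nat -> 'rV[R]_3 * R;
  rih_root : Om -> nat;
  rih_dual : Om -> wgraph := fun w i j =>
    if share_edge (rih_poly w) (rih_label w i) (rih_label w j)
    then dihedral (rih_label w i) (rih_label w j) else 0;
  rih_labelP : forall w, set_bij [set: nat] (faces (rih_poly w)) (rih_label w);
  rih_dual_measurable : measurable_fun setT rih_dual;
  rih_root_measurable : measurable_fun setT rih_root
}.

Definition root_face (X : random_rooted_ihp) (w : Om) : 'rV[R]_3 * R :=
  rih_label X w (rih_root X w).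

Definition unimodular (X : random_rooted_ihp) : Prop :=
  forall F : wgraph -> nat -> nat -> \bar R,
    (forall W u v, 0 <= F W u v)%E ->
    (forall u v, measurable_fun setT (fun W => F W u v)) ->
    iso_invariant F ->
    (\int[Pr]_w (\sum_(0 <= v <oo) F (rih_dual X w) (rih_root X w) v) =
     \int[Pr]_w (\sum_(0 <= v <oo) F (rih_dual X w) v (rih_root X w)))%E.

End Unimodular.

(* Main.v *)
(* Mass transport on the dual graph. By (C1) every ideal vertex v of degree n
   carries angles of total (n - 2) pi, so the vertex sum in kappa is the sum over
   v at f of (1/n) times the total angle at v. Let every face g at v receive from
   each face f at v the mass (1/n) times half the two angles at v on edges of g.
   Then f sends the vertex sum of kappa, while g receives the sum of its dihedral
   angles, each edge of g having exactly two ideal vertices; unimodularity equates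
   the two expectations.
   The transport function must depend on the weighted dual graph only: by (C1) and
   (C2) the ideal vertices are recovered from it as the simple cycles of exterior
   angle sum 2 pi, up to base point and orientation. This also makes T and kappa
   measurable. *)
Require Import Defs.
From HB Require Import structures.
From mathcomp Require Import all_boot all_order all_algebra.
From mathcomp Require Import all_classical all_reals all_analysis measurable_realfun.
From mathcomp Require Import lra.

Set Implicit Arguments.
Unset Strict Implicit.
Unset Printing Implicit Defensive.

Import Order.TTheory GRing.Theory Num.Theory.
Local Open Scope ring_scope.
Local Open Scope ereal_scope.

(** * Cyclic sequences up to base point and orientation *)

Section Cycles.
Local Open Scope nat_scope.
Variable T : choiceType.
Implicit Types (c : seq T) (x y : T).

(** A duplicate-free sequence is the orbit of its head under its successor function, cut off at its
    length. Membership together with index 0 says that [x] is the head. *)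
Lemma eq_next_eq c c' x : uniq c -> uniq c' -> size c = size c' ->
  x \in c -> x \in c' -> index x c = 0 -> index x c' = 0 ->
  next c =1 next c' -> c = c'.
Proof.
have traj s : uniq s -> x \in s -> index x s = 0 ->
    s = traject (next s) x (size s).
  case: s => [|y s]// us _ /=; case: eqVneq => // <- _.
  have := cycle_next us; rewrite /= rcons_path => /andP[/fpathP[n sE] _].
  have := congr1 size sE; rewrite size_traject => nE.
  by congr cons; rewrite nE.
move=> uc uc' sc xc xc' ic ic' nE.
rewrite (traj _ uc xc ic) (traj _ uc' xc' ic') sc.
by elim: (size c') x {traj xc xc' ic ic'} => //= n IH x; rewrite nE IH.
Qed.

(** With [x] rotated to the head, the two neighbours are the second and the last entries. This is
    what tells the two orientations of a cycle apart. *)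
Lemma next_neq_prev c x : uniq c -> 2 < size c -> x \in c ->
  next c x != prev c x.
Proof.
move=> uc sc xc.
have [i s cE] := rot_to xc.
rewrite -(next_rot i uc) -(prev_rot i uc).
move: uc sc; rewrite -(rot_uniq i) -(size_rot i c) cE.
case: s {cE} => [|y s]// us sc.
have xs : x \notin y :: s by case/andP: us.
have := @nth_uniq _ x [:: x, y & s] 1 (size s).+1 isT (ltnSn _) us.
rewrite next_nth prev_nth mem_head (memNindex xs) index_head /= => ->.
by case: s sc {us xs}.
Qed.

Lemma same_cycle_perm c c' : same_cycle c c' -> perm_eq c c'.
Proof.
move=> [k [|]->]; first by rewrite perm_sym perm_rot.
by rewrite perm_sym perm_rot perm_rev.
Qed.

Lemma same_cycle_mem c c' : same_cycle c c' -> c' =i c.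
Proof. by move=> /same_cycle_perm/perm_mem cc' x; rewrite cc'. Qed.

Lemma same_cycle_size c c' : same_cycle c c' -> size c' = size c.
Proof. by move=> /same_cycle_perm/perm_size. Qed.

Lemma same_cycle_uniq c c' : same_cycle c c' -> uniq c' = uniq c.
Proof. by move=> /same_cycle_perm/perm_uniq. Qed.

Lemma same_cycle_next c c' : uniq c -> same_cycle c c' ->
  next c' =1 next c /\ prev c' =1 prev c \/
  next c' =1 prev c /\ prev c' =1 next c.
Proof.
move=> uc [k [|]->]; [left|right]; split=> x.
- exact: next_rot.
- exact: prev_rot.
- by rewrite next_rot ?rev_uniq// next_rev.
- by rewrite prev_rot ?rev_uniq// prev_rev.
Qed.

Lemma cycle_edgeE c x y : uniq c ->
  cycle_edge c x y = (x \in c) && ((y == next c x) || (y == prev c x)).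
Proof.
move=> uc; rewrite /cycle_edge; case: (boolP (x \in c)) => //= xc.
rewrite -(can2_eq (prev_next uc) (next_prev uc)) (eq_sym _ x).
case: (boolP (y \in c)) => //= yc; apply/esym/negbTE.
apply: contra yc => /orP[/eqP->|/eqP xE]; first by rewrite mem_next.
by rewrite -(mem_next c) -xE.
Qed.

Lemma same_cycle_edge c c' : uniq c -> same_cycle c c' ->
  cycle_edge c' =2 cycle_edge c.
Proof.
move=> uc cc' x y; rewrite !cycle_edgeE ?(same_cycle_uniq cc')//.
rewrite (same_cycle_mem cc').
by case: (same_cycle_next uc cc') => -[-> ->]; rewrite // orbC.
Qed.

(** For [x] on [c], the two values of [b] give all representatives of the closed curve [c] that
    start at [x]; [true] keeps the direction. *)
Definition orient (b : bool) c x : seq T :=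
  let c' := if b then c else rev c in rot (index x c') c'.

Lemma same_cycle_orient b c x : same_cycle c (orient b c x).
Proof. by case: b; eexists; [left|right]. Qed.

Lemma next_orient b c x : uniq c ->
  next (orient b c x) =1 (if b then next c else prev c).
Proof.
move=> uc y; case: b; rewrite next_rot ?rev_uniq//.
exact: next_rev.
Qed.

Lemma index_orient b c x : x \in c -> index x (orient b c x) = 0.
Proof.
move=> xc; rewrite /orient rot_index ?index_head//.
by case: b; rewrite ?mem_rev.
Qed.

Lemma orientP c c' x : uniq c -> same_cycle c c' -> x \in c ->
  index x c' = 0 -> exists b, c' = orient b c x.
Proof.
move=> uc cc' xc ic'.
have main b : next c' =1 (if b then next c else prev c) -> c' = orient b c x.
  move=> nE; apply: (@eq_next_eq _ _ x) => //.
  - by rewrite (same_cycle_uniq cc').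
  - by rewrite (same_cycle_uniq (same_cycle_orient b c x)).
  - by rewrite (same_cycle_size cc') (same_cycle_size (same_cycle_orient b c x)).
  - by rewrite (same_cycle_mem cc').
  - by rewrite (same_cycle_mem (same_cycle_orient b c x)).
  - exact: index_orient.
  - by move=> y; rewrite next_orient.
by case: (same_cycle_next uc cc') => -[nE _];
  [exists true|exists false]; exact: main.
Qed.

Lemma map_next c : uniq c -> perm_eq [seq next c x | x <- c] c.
Proof.
move=> uc; apply: uniq_perm => //.
  by rewrite map_inj_uniq//; exact: can_inj (prev_next uc).
move=> x; apply/mapP/idP => [[y yc ->]|xc]; first by rewrite mem_next.
by exists (prev c x); rewrite ?mem_prev// next_prev.
Qed.

Lemma same_cycle_simple (E : rel T) c c' : symmetric E ->
  same_cycle c c' -> simple_cycle E c -> simple_cycle E c'.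
Proof.
move=> Esym cc' [uc sc Ec]; split.
- by rewrite (same_cycle_uniq cc').
- by rewrite (same_cycle_size cc').
- move: cc' => [k [|]->]; rewrite rot_cycle// rev_cycle.
  by rewrite (eq_cycle (e' := E))// => x y; rewrite Esym.
Qed.

Lemma same_cycle_exterior_sum (R : realType) (Theta : T -> T -> R) c c' :
  uniq c -> {in c, forall x, Theta x (next c x) = Theta (next c x) x} ->
  same_cycle c c' -> exterior_sum Theta c' = exterior_sum Theta c.
Proof.
move=> uc Tsym cc'; rewrite /exterior_sum -(perm_big _ (same_cycle_perm cc'))/=.
case: (same_cycle_next uc cc') => -[nE _].
  by apply: eq_bigr => x _; rewrite nE.
(* Under reversal the edge leaving [x] goes to [prev c x]. Reindexing along the permutation [next c]
   returns the original edges, read from their other ends. *)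
rewrite -(perm_big _ (map_next uc)) big_map [LHS]big_seq [RHS]big_seq.
by apply: eq_bigr => x xc; rewrite nE prev_next// -Tsym.
Qed.

End Cycles.

(** * Unordered sums of nonnegative terms *)

Section Summation.
Local Open Scope classical_set_scope.
Variable R : realType.

(** The map sending [i] to [(p i, i)] is a bijection onto the disjoint union of the fibres. All
    regroupings of transported mass below go through this. *)
Lemma esum_fibration (I J : choiceType) (A : set I) (B : set J) (p : I -> J)
    (a : I -> \bar R) :
  (forall i, A i -> B (p i)) -> (forall i, A i -> 0 <= a i) ->
  \esum_(i in A) a i =
  \esum_(j in B) \esum_(i in A `&` p @^-1` [set j]) a i.
Proof.
move=> AB a0; rewrite esum_esum/=; last by move=> j i _ [/a0].
apply: reindex_esum; split.
- by move=> [j i] /= [_ []].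
- move=> [j i] [j' i'] /set_mem[/= _ [_ <-]] /set_mem[/= _ [_ <-]].
  by move=> ->.
- by move=> i Ai; exists (p i, i) => //=; split => //=; exact: AB.
Qed.

Lemma esum_seq (I : choiceType) (s : seq I) (a : I -> \bar R) : uniq s ->
  (forall i, i \in s -> 0 <= a i) ->
  \esum_(i in [set` s]) a i = \sum_(i <- s) a i.
Proof.
move=> us a0; rewrite (fsbig_seq _ a us) esum_fset//.
by move=> i; rewrite inE/=; exact: a0.
Qed.

Lemma esum_set2 (I : choiceType) (i j : I) (a : I -> \bar R) : i <> j ->
  0 <= a i -> 0 <= a j -> \esum_(k in [set i; j]) a k = a i + a j.
Proof.
move=> ij ai aj.
have -> : [set i; j] = [set` [:: i; j]].
  apply/seteqP; split=> k /=; rewrite !inE.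
    by case=> ->; rewrite eqxx// orbT.
  by case/orP=> /eqP ->; [left|right].
rewrite esum_seq ?big_cons ?big_nil ?adde0//=.
  by rewrite inE andbT; exact/eqP.
by move=> k; rewrite !inE => /orP[]/eqP->.
Qed.

End Summation.

(** * Boundary cycles of a disk decomposition *)

Section Disk.
Local Open Scope classical_set_scope.
Variables (T U : choiceType) (V : set T) (E : rel T) (F : set U).
Variable bd : U -> seq T.
Hypothesis D : disk_decomposition V E F bd.

Lemma edge_next c x : simple_cycle E c -> x \in c -> E x (next c x).
Proof. by move=> [_ _ Ec] xc; exact: next_cycle. Qed.

Lemma edge_prev c x : simple_cycle E c -> x \in c -> E x (prev c x).
Proof.
move=> [_ _ Ec] xc; rewrite (decomp_sym D); exact: prev_cycle.
Qed.

Lemma simple_cycle_sub c x : simple_cycle E c -> x \in c -> V x.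
Proof. by move=> Ec xc; case: (decomp_vertex D (edge_next Ec xc)). Qed.

(* If two 2-cells had the same boundary cycle, the link of each of its vertices
   would consist of its two neighbours on the cycle, so that the connected,
   infinite graph would be reduced to that cycle. *)
Lemma bounding_face_unique f g c : F f -> F g ->
  same_cycle (bd f) c -> same_cycle (bd g) c -> f = g.
Proof.
move=> Ff Fg fc gc; apply: contrapT => fg.
have Ef := decomp_face D Ff; have Eg := decomp_face D Fg.
have [uf _ _] := Ef; have [ug _ _] := Eg.
have uc : uniq c by rewrite (same_cycle_uniq fc).
have Ec := same_cycle_simple (decomp_sym D) fc Ef.
(* The two 2-cells on an edge of [c] are already [f] and [g], so no third one contains it. *)
have only h x y : F h -> E x y -> cycle_edge c x y ->
    cycle_edge (bd h) x y -> h = f \/ h = g.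
  move=> Fh Exy cxy hxy.
  have [f' [g' [_ _ _ fg'P]]] := decomp_edge D Exy.
  have := fg'P f Ff; rewrite -(same_cycle_edge uf fc) => -[/(_ cxy) f1 _].
  have := fg'P g Fg; rewrite -(same_cycle_edge ug gc) => -[/(_ cxy) g1 _].
  have [/(_ hxy) h1 _] := fg'P h Fh.
  case: f1 g1 fg h1 => -> [] -> fg [] ->; by [left|right|case: fg].
(* Walk in the link of [x] from [next c x] to [y]: each 2-cell crossed is [f] or [g], whose corner
   at [x] only swaps the two neighbours on [c]. *)
have nbr x y : x \in c -> E x y -> y = next c x \/ y = prev c x.
  move=> xc Exy.
  have [p xp <-] := decomp_link D (edge_next Ec xc) Exy.
  suff: forall a, a = next c x \/ a = prev c x -> path (link F bd x) a p ->
      last a p = next c x \/ last a p = prev c x.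
    by apply=> //; left.
  elim: p {xp Exy} => //= b p IH a aE /andP[/asboolP[h Fh hxab] bp].
  apply: (IH b _ bp).
  have uh : uniq (bd h) by case: (decomp_face D Fh).
  move: hxab => /andP[xh hxab].
  have Exa : E x a by case: aE => ->; [exact: edge_next|exact: edge_prev].
  have hE : h = f \/ h = g.
    apply: (@only h x a) => //.
      by rewrite cycle_edgeE// xc; case: aE => ->; rewrite eqxx ?orbT.
    rewrite cycle_edgeE// xh.
    by case/orP: hxab => /andP[/eqP-> _]; rewrite eqxx ?orbT.
  have hc : same_cycle (bd h) c by case: hE => ->.
  by case: (same_cycle_next uh hc) => -[-> ->];
    case/orP: hxab => /andP[_ /eqP->]; auto.
have [x xc] : exists x, x \in c.
  by case: (c) Ec => [[]//|x s _]; exists x; rewrite mem_head.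
apply: (decomp_infinite D); apply: (@sub_finite_set _ _ [set` c]).
  move=> y Vy /=.
  have [p + <-] := decomp_connected D (simple_cycle_sub Ec xc) Vy.
  elim: p x xc {y Vy} => //= y p IH x xc /andP[Exy]; apply: IH.
  by case: (nbr _ _ xc Exy) => ->; rewrite ?mem_next ?mem_prev.
exact: finite_seq.
Qed.

(** A 2-cell at [x] contains one of the finitely many edges at [x], and each of these lies on two
    2-cells. *)
Lemma finite_faces_at x : V x -> finite_set [set f | F f /\ x \in bd f].
Proof.
move=> Vx; apply: (@sub_finite_set _ _ (\bigcup_(y in [set y | E x y])
    [set f | F f /\ cycle_edge (bd f) x y])).
  move=> f [Ff xf]; have Ef := decomp_face D Ff; have [uf _ _] := Ef.
  exists (next (bd f) x) => /=; first exact: edge_next.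
  by split => //; rewrite cycle_edgeE// xf eqxx.
apply: bigcup_finite; first exact: (decomp_locally_finite D).
move=> y Exy; have [f [g [Ff Fg fg fgP]]] := decomp_edge D Exy.
apply: (@sub_finite_set _ _ [set f; g]).
  by move=> h [Fh hxy]; apply/fgP.
exact: finite_set2.
Qed.

End Disk.

(** * The mass transport of a weighted graph *)

Section Transport.
Local Open Scope classical_set_scope.
Variables (R : realType) (T : choiceType) (E : rel T) (Theta : T -> T -> R).

(** An intrinsic substitute for the 2-cells: only adjacency and weights occur, so every base point
    and both orientations are present. *)
Definition flat_cycles : set (seq T) :=
  [set c | simple_cycle E c /\ exterior_sum Theta c = (2 * pi)%R].

Definition flat_cycles_from (x : T) : set (seq T) :=
  [set c | [/\ flat_cycles c, x \in c & index x c = 0%N]].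

(* A 2-cell having x and y on its boundary occurs twice below, once for each of
   its orientations starting at y, whence the factor 2. *)
Definition transport (x y : T) : \bar R :=
  \esum_(c in flat_cycles_from y `&` [set c | x \in c])
    (Theta y (next c y) / (2 * (size c)%:R))%:E.

Lemma flat_cycles_rot c k : flat_cycles c -> flat_cycles (rot k c).
Proof.
move=> [[uc sc Ec] Tc]; split.
  by split; rewrite ?rot_uniq ?size_rot ?rot_cycle.
rewrite -Tc /exterior_sum (perm_big c) ?perm_rot//=.
by apply: eq_bigr => x _; rewrite next_rot.
Qed.

Lemma flat_cycles_from_rot c x : flat_cycles c -> x \in c ->
  flat_cycles_from x (rot (index x c) c).
Proof.
move=> cF xc; split; first exact: flat_cycles_rot.
  by rewrite mem_rot.
by rewrite rot_index ?index_head.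
Qed.

Hypothesis Theta_ge0 : forall x y, E x y -> (0 <= Theta x y)%R.

Lemma transport_term_ge0 (y : T) (c : seq T) : flat_cycles_from y c ->
  0 <= (Theta y (next c y) / (2 * (size c)%:R))%:E.
Proof.
move=> [[[_ _ Ec] _] yc _]; rewrite lee_fin divr_ge0 ?mulr_ge0//.
by rewrite Theta_ge0// next_cycle.
Qed.

Lemma transport_ge0 (x y : T) : 0 <= transport x y.
Proof. by apply: esum_ge0 => c [+ _]; exact: transport_term_ge0. Qed.

End Transport.

(** Rebasing at another vertex is undone by rebasing at the old head: both sides have head [x] and
    the same successor function. *)
Lemma rot_index_rot (T : choiceType) (c : seq T) (x : T) (k : nat) : uniq c ->
  x \in c -> index x c = 0%N -> rot (index x (rot k c)) (rot k c) = c.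
Proof.
move=> uc xc ic.
apply: (@eq_next_eq _ _ _ x); rewrite ?rot_uniq ?size_rot ?mem_rot//.
  by rewrite rot_index ?index_head ?mem_rot.
by move=> y; rewrite !next_rot ?rot_uniq.
Qed.

(** * Mass sent and received in an ideal angled graph *)

Section AngledGraph.
Local Open Scope classical_set_scope.
Variables (R : realType) (T U : choiceType) (V : set T) (E : rel T).
Variables (F : set U) (bd : U -> seq T) (Theta : T -> T -> R).
Hypothesis G : ideal_angled_graph V E F bd Theta.

Let D := iag_decomposition G.
Let Esym := decomp_sym D.
Local Notation flat_cycles := (flat_cycles E Theta).
Local Notation flat_cycles_from := (flat_cycles_from E Theta).
Local Notation transport := (transport E Theta).

Lemma angle_ge0 x y : E x y -> (0 <= Theta x y)%R.
Proof. by move=> /(iag_angle G)/andP[/ltW]. Qed.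

Lemma face_flat_cycle f c : F f -> same_cycle (bd f) c -> flat_cycles c.
Proof.
move=> Ff fc; have Ef := decomp_face D Ff; have [uf _ _] := Ef.
split; first exact: same_cycle_simple Ef.
rewrite (same_cycle_exterior_sum uf _ fc) ?(iag_C1 G Ff)//.
by move=> x xf; apply: (iag_sym G); exact: edge_next.
Qed.

(** The strictness of (C2) rules out a non-bounding cycle of exterior sum [2 * pi]. *)
Lemma flat_cycle_face c : flat_cycles c -> exists2 f, F f & same_cycle (bd f) c.
Proof.
move=> [Ec sc]; apply: contrapT => nc.
by have := iag_C2 G Ec nc; rewrite sc ltxx.
Qed.

Lemma face_orient f b x : F f -> x \in bd f ->
  flat_cycles_from x (orient b (bd f) x).
Proof.
move=> Ff xf; have so := same_cycle_orient b (bd f) x.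
split; first exact: face_flat_cycle so.
  by rewrite (same_cycle_mem so).
exact: index_orient.
Qed.

(** Flat cycles starting at [x] correspond bijectively to pairs of a 2-cell at [x] and an
    orientation, hence each 2-cell counts twice. *)
Lemma esum_flat_cycles_from x (g : nat -> \bar R) :
  (forall n, (2 < n)%N -> 0 <= g n) ->
  \esum_(c in flat_cycles_from x) g (size c) =
  \esum_(f in [set f | F f /\ x \in bd f]) (g (size (bd f)) + g (size (bd f))).
Proof.
move=> g0.
have gf f : F f -> 0 <= g (size (bd f)).
  by move=> /(decomp_face D)[_ sf _]; exact: g0.
transitivity (\esum_(k in [set f | F f /\ x \in bd f] `*` [set: bool])
    g (size (bd k.1))).
  rewrite (@reindex_esum _ _ _
    ([set f | F f /\ x \in bd f] `*` [set: bool]) _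
    (fun k => orient k.2 (bd k.1) x)).
    apply: eq_esum => -[f b] _ /=.
    by rewrite (same_cycle_size (same_cycle_orient b (bd f) x)).
  split.
  - by move=> [f b] [/= [Ff xf] _]; exact: face_orient.
  (* Injectivity: the curve determines the 2-cell, and the successor of [x] determines the
     orientation. *)
  - move=> [f b] [g' b'] /set_mem[/= [Ff xf] _] /set_mem[/= [Fg xg] _] oE.
    have fg : f = g'.
      apply: (bounding_face_unique D Ff Fg (same_cycle_orient b _ x)).
      by rewrite oE; exact: same_cycle_orient.
    move: oE; rewrite fg => oE; congr pair; apply: contrapT => bb'.
    have [ug sg _] := decomp_face D Fg.
    have := congr1 (fun c => next c x) oE; rewrite !next_orient//.
    have := next_neq_prev ug sg xg.
    by case: b b' bb' {oE} => -[]// _ /eqP n e; apply: n.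
  - move=> c [cF xc ic]; have [f Ff fc] := flat_cycle_face cF.
    have [uf _ _] := decomp_face D Ff.
    have xf : x \in bd f by rewrite -(same_cycle_mem fc).
    by have [b cE] := orientP uf fc xf ic; exists (f, b).
rewrite -(@esum_esum _ _ _ _ (fun=> [set: bool]) (fun f _ => g (size (bd f)))).
  apply: eq_esum => f [Ff _].
  have -> : [set: bool] = [set true; false].
    by apply/seteqP; split=> // -[]/= _; [left|right].
  by rewrite esum_set2// gf.
by move=> f _ [Ff _] _; exact: gf.
Qed.

(** Exactly two 2-cells contain the edge from [x] to [y], and each has exactly one orientation in
    which [y] follows [x]. *)
Lemma esum_flat_cycles_next x (h : T -> \bar R) :
  (forall y, E x y -> 0 <= h y) ->
  \esum_(c in flat_cycles_from x) h (next c x) =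
  \esum_(y in [set y | E x y]) (h y + h y).
Proof.
move=> h0.
have Enext c : flat_cycles_from x c -> E x (next c x).
  by move=> [[Ec _] xc _]; exact: edge_next.
rewrite (esum_fibration (B := [set y | E x y]) (p := fun c => next c x))//;
  last by move=> c /Enext/h0.
apply: eq_esum => y /= Exy.
have [f [g [Ff Fg fg fgP]]] := decomp_edge D Exy.
(* The boundary of [k], oriented so as to leave [x] towards [y]. *)
pose dart k := orient (next (bd k) x == y) (bd k) x.
have dartP k : F k -> cycle_edge (bd k) x y ->
    flat_cycles_from x (dart k) /\ next (dart k) x = y.
  move=> Fk; have [uk _ _] := decomp_face D Fk.
  rewrite cycle_edgeE// => /andP[xk /orP yE].
  split; first exact: face_orient.
  rewrite next_orient//; case: eqVneq => // nE.
  by case: yE => /eqP// yE; rewrite yE eqxx in nE.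
have fxy : cycle_edge (bd f) x y by apply/fgP; [|left].
have gxy : cycle_edge (bd g) x y by apply/fgP; [|right].
rewrite (_ : _ `&` _ = [set dart f; dart g]).
  have [_ df] := dartP _ Ff fxy; have [_ dg] := dartP _ Fg gxy.
  rewrite esum_set2 ?df ?dg ?h0//.
  move=> dfg; apply: fg.
  apply: (bounding_face_unique D (c := dart f)) => //.
    exact: same_cycle_orient.
  rewrite dfg; exact: same_cycle_orient.
apply/seteqP; split=> [c [cF /= nE]|c [->|->]]; [|exact: dartP..].
have [cC xc ic] := cF; have [k Fk kc] := flat_cycle_face cC.
have [uk sk _] := decomp_face D Fk.
have xk : x \in bd k by rewrite -(same_cycle_mem kc).
have kxy : cycle_edge (bd k) x y.
  rewrite -(same_cycle_edge uk kc) cycle_edgeE ?(same_cycle_uniq kc)//.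
  by rewrite xc nE eqxx.
suff -> : c = dart k by case/fgP: kxy => // ->; [left|right].
have [b cE] := orientP uk kc xk ic.
rewrite cE /dart; congr orient; move: nE; rewrite cE next_orient//.
case: b {cE} => [->|<-]; first by rewrite eqxx.
by apply/esym/negbTE/next_neq_prev.
Qed.

Lemma sum_flat_cycle c : flat_cycles c ->
  (\sum_(x <- c) Theta x (next c x) = ((size c)%:R - 2) * pi)%R.
Proof.
move=> [_]; rewrite /exterior_sum sumrB big_const_seq count_predT iter_addr_0.
by rewrite mulrBl => <-; rewrite mulr_natl subKr.
Qed.

(** Group the pairs (receiver [y], cycle based at [y] through [x]) by the cycle rebased at [x]. A
    cycle of length n then carries its total angle (n - 2) pi divided by 2n, and each 2-cell
    supplies two cycles. *)
Lemma transport_out x : \esum_(y in V) transport x y =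
  \esum_(f in [set f | F f /\ x \in bd f])
    (((size (bd f))%:R - 2) * pi / (size (bd f))%:R)%:E.
Proof.
pose g (n : nat) : \bar R := ((n%:R - 2) * pi / (2 * n%:R))%:E.
transitivity (\esum_(c in flat_cycles_from x) g (size c)); last first.
  rewrite esum_flat_cycles_from; last first.
    move=> n n2; rewrite lee_fin divr_ge0// ?mulr_ge0 ?pi_ge0// subr_ge0.
    by rewrite ler_nat ltnW.
  apply: eq_esum => f _; rewrite /g -EFinD; congr EFin.
  by rewrite invfM mulrCA mulrC -splitr.
have term0 y c : V y -> (flat_cycles_from y `&` [set c | x \in c]) c ->
    0 <= (Theta y (next c y) / (2 * (size c)%:R))%:E.
  by move=> _ [+ _]; apply: transport_term_ge0; exact: angle_ge0.
rewrite /transport esum_esum//.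
rewrite (esum_fibration (B := flat_cycles_from x)
  (p := fun k => rot (index x k.2) k.2)); first last.
- by move=> [y c] [/= Vy yc]; exact: term0.
- move=> [y c] [/= _ [[cF _ _] /= xc]].
  exact: flat_cycles_from_rot.
apply: eq_esum => c [cF xc ic].
have [Ec _] := cF; have [uc sc _] := Ec.
(* The fibre over [c] consists of its rebasings at each of its vertices. *)
rewrite (@reindex_esum _ _ _ [set` c] _ (fun z => (z, rot (index z c) c))).
  rewrite /= esum_seq//.
    under eq_bigr do rewrite next_rot// size_rot.
    by rewrite sumEFin -mulr_suml (sum_flat_cycle cF).
  move=> z zc; rewrite next_rot// size_rot lee_fin divr_ge0 ?mulr_ge0//.
  by apply: angle_ge0; exact: edge_next.
split.
- move=> z /= zc; split => /=; last exact: rot_index_rot.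
  split => /=; first exact: (simple_cycle_sub D Ec zc).
  by split; [exact: flat_cycles_from_rot|rewrite /= mem_rot].
- by move=> z z' _ _ [].
- move=> [y d] [/= [/= Vy [[[[ud _ _] _] yd id] /= xd]] dE].
  by exists y; rewrite ?dE -?dE/= ?mem_rot// rot_index_rot.
Qed.

(** Group by the cycle based at [y]: its n vertices each send 1/(2n) of the angle on its first edge,
    in total half that angle, and each edge at [y] is the first edge of two cycles. *)
Lemma transport_in y : \esum_(x in V) transport x y =
  \esum_(z in [set z | E y z]) (Theta y z)%:E.
Proof.
have term0 x c : V x -> (flat_cycles_from y `&` [set c | x \in c]) c ->
    0 <= (Theta y (next c y) / (2 * (size c)%:R))%:E.
  by move=> _ [+ _]; apply: transport_term_ge0; exact: angle_ge0.
transitivity (\esum_(c in flat_cycles_from y) (Theta y (next c y) / 2)%:E);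
    last first.
  rewrite (esum_flat_cycles_next (h := fun z => (Theta y z / 2)%:E)).
    by apply: eq_esum => z _; rewrite -EFinD -splitr.
  by move=> z /angle_ge0 ?; rewrite lee_fin divr_ge0.
rewrite /transport esum_esum//.
rewrite (esum_fibration (B := flat_cycles_from y) (p := snd)); first last.
- by move=> [x c] [/= Vx yc]; exact: (term0 x).
- by move=> [x c] [/= _ []].
apply: eq_esum => c cF; have [[Ec _] yc ic] := cF.
have [uc sc _] := Ec.
rewrite (@reindex_esum _ _ _ [set` c] _ (fun z => (z, c))).
  rewrite /= esum_seq//; last by move=> *; apply: transport_term_ge0 cF; exact: angle_ge0.
  rewrite sumEFin big_const_seq count_predT iter_addr_0; congr EFin.
  rewrite -[LHS]mulr_natl invfM mulrCA; congr (_ * _)%R.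
  by rewrite mulrCA mulfV ?mulr1// pnatr_eq0 -lt0n (leq_trans _ sc).
split.
- move=> z /= zc; split => //=; split => //=; exact: (simple_cycle_sub D Ec zc).
- by move=> z z' _ _ [].
- by move=> [z d] [/= [_ [_ /= zd]] <-]; exists z.
Qed.

End AngledGraph.

(** * Invariance of the transport under relabelling *)

Section Relabeling.
Local Open Scope classical_set_scope.
Variables (R : realType) (T T' : choiceType).
Variables (E : rel T) (Theta : T -> T -> R).
Variables (E' : rel T') (Theta' : T' -> T' -> R) (l : T' -> T).
Hypothesis l_inj : injective l.
Hypothesis EE' : forall i j, E' i j = E (l i) (l j).
Hypothesis ThetaE' : forall i j, E' i j -> Theta' i j = Theta (l i) (l j).
Hypothesis l_surj : forall x y, E x y -> exists i, l i = x.

Lemma flat_cycles_map c : flat_cycles E' Theta' c <-> flat_cycles E Theta (map l c).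
Proof.
have simpleE : simple_cycle E' c <-> simple_cycle E (map l c).
  rewrite /simple_cycle map_inj_uniq// size_map cycle_map.
  by rewrite (eq_cycle (e := E') (e' := relpre l E)).
have extE : simple_cycle E' c ->
    exterior_sum Theta (map l c) = exterior_sum Theta' c.
  move=> Ec; have [uc _ _] := Ec.
  rewrite /exterior_sum big_map [LHS]big_seq [RHS]big_seq.
  apply: eq_bigr => i ic; rewrite (next_map l_inj)// ThetaE'//.
  exact: edge_next.
split=> -[Ec Tc]; split.
- exact/simpleE.
- by rewrite extE.
- exact/simpleE.
- by rewrite -extE//; exact/simpleE.
Qed.

Lemma transport_map i j :
  transport E' Theta' i j = transport E Theta (l i) (l j).
Proof.
rewrite /transport [RHS](@reindex_esum _ _ _
  (flat_cycles_from E' Theta' j `&` [set c | i \in c]) _ (map l)).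
  apply: eq_esum => c [[cF jc _] _]; have [[uc _ _] _] := cF.
  have [Ec _] : flat_cycles E Theta (map l c) by exact/flat_cycles_map.
  rewrite size_map (next_map l_inj)// ThetaE'// EE' -(next_map l_inj)//.
  by apply: edge_next => //; rewrite mem_map.
split.
- move=> c [[cF jc ic] /= xc]; split; last by rewrite /= mem_map.
  by split; [exact/flat_cycles_map|rewrite mem_map|rewrite index_map].
- by move=> c c' _ _ /(inj_map l_inj).
- move=> c [[cF jc ic] /= xc].
  (* Every entry of [c] is an endpoint of an edge, hence a label value, so [c] lifts entry by
     entry. *)
  have [c' cE] : exists c', map l c' = c.
    have : forall x, x \in c -> exists k, l k = x.
      by case: cF => Ec _ x /(edge_next Ec); exact: l_surj.
    elim: (c) => [|x s IH] sl; first by exists [::].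
    have [|s' <-] := IH; first by move=> y ys; apply: sl; rewrite inE ys orbT.
    by have [k <-] := sl x (mem_head _ _); exists (k :: s').
  exists c' => //; move: cF jc ic xc; rewrite -cE !mem_map// index_map// => cF.
  by move=> ? ? ?; split => //; split => //; exact/flat_cycles_map.
Qed.

End Relabeling.

(** * Borel measurability of the transport *)

Section Measurability.
Import numFieldNormedType.Exports.
Local Open Scope classical_set_scope.
Variable R : realType.
Local Notation wgraph := (g_sigma_algebraType (@cylinder R)).

(** Adjacency is read off as positivity of the weight, so this makes sense for every weight matrix,
    as unimodularity demands of a test function. *)
Definition wtransport (W : wgraph) (u v : nat) : \bar R :=
  transport (fun i j => (0 < W i j)%R) W u v.

Lemma wtransport_ge0 W u v : 0 <= wtransport W u v.
Proof. by apply: transport_ge0 => i j /ltW. Qed.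

Lemma measurable_weight i j : measurable_fun setT (fun W : wgraph => W i j).
Proof.
move=> _ B mB; rewrite setTI; apply: sub_sigma_algebra.
by exists i, j, B.
Qed.

Lemma measurable_fun_path (s : seq nat) (i : nat) :
  measurable_fun setT (fun W : wgraph => path (fun i j => (0 < W i j)%R) i s).
Proof.
elim: s i => [|j s IH] i /=; first exact: measurable_cst.
apply: measurable_and; last exact: IH.
by apply: measurable_fun_ltr; [exact: measurable_cst|exact: measurable_weight].
Qed.

(** There are countably many finite sequences of integers, and the term of each is a measurable
    function of finitely many weights. *)
Lemma measurable_wtransport u v :
  measurable_fun setT (fun W : wgraph => wtransport W u v).
Proof.
pose e (W : wgraph) : rel nat := fun i j => (0 < W i j)%R.
pose b (c : seq nat) W := [&& uniq c, (2 < size c)%N, cycle (e W) c,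
  exterior_sum W c == (2 * pi)%R, v \in c, index v c == 0%N & u \in c].
have bP c W : (c \in flat_cycles_from (e W) W v `&` [set c | u \in c]) = b c W.
  apply/idP/idP.
    move=> /set_mem[[[[? ? ?] Tc] ? ic] ?]; apply/and5P; split => //.
      exact/eqP.
    by apply/and3P; split => //; exact/eqP.
  move=> /and5P[? ? ? /eqP ? /and3P[? /eqP ? ?]]; apply/mem_set.
  by do 2?split.
(* Sequences are enumerated by their codes; those that are not flat cycles from [v] through [u]
   contribute 0. *)
pose t n W : \bar R := if b (CodeSeq.decode n) W then
  (W v (next (CodeSeq.decode n) v) / (2 * (size (CodeSeq.decode n))%:R))%:E
  else 0.
have tE W : wtransport W u v = \sum_(0 <= n <oo | n \in xpredT) t n W.
  rewrite /wtransport /transport esum_mkcond.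
  rewrite (@reindex_esum _ _ _ [set: nat] _ CodeSeq.decode).
    rewrite nneseries_esum.
      rewrite [X in _ = esum X _](_ : _ = [set: nat]).
        by apply: eq_esum => n _; rewrite bP.
      by apply/seteqP; split.
    move=> n _; rewrite /t -bP; case: ifPn => // /set_mem[+ _].
    by apply: transport_term_ge0 => i j /ltW.
  split=> //; first by move=> n m _ _; exact: (can_inj CodeSeq.decodeK).
  by move=> c _; exists (CodeSeq.code c) => //; exact: CodeSeq.codeK.
rewrite (_ : (fun W => _) = (fun W => \sum_(0 <= n <oo | n \in xpredT) t n W));
  last by apply/funext => W; exact: tE.
apply: ge0_emeasurable_sum => [n W _ _|n _].
  rewrite /t -bP; case: ifPn => // /set_mem[+ _].
  by apply: transport_term_ge0 => i j /ltW.
rewrite /t; move: (CodeSeq.decode n) => c.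
apply: measurable_fun_ifT; last exact: measurable_cst.
  rewrite /b; do 2 (apply: measurable_and; first exact: measurable_cst).
  apply: measurable_and; last apply: measurable_and; last exact: measurable_cst.
    by case: (c) => [|x s]; [exact: measurable_cst|exact: measurable_fun_path].
  apply: measurable_fun_eqr; last exact: measurable_cst.
  apply: measurable_sum => i; apply: measurable_funB.
    exact: measurable_cst.
  exact: measurable_weight.
apply/measurable_EFinP; apply: measurable_funM; last exact: measurable_cst.
exact: measurable_weight.
Qed.

Lemma iso_invariant_wtransport : iso_invariant wtransport.
Proof.
move=> s W u v [t st ts]; rewrite /wtransport.
rewrite (@transport_map _ _ _ (fun i j => (0 < W i j)%R) W _ _ s)//.
  exact: can_inj st.
by move=> i j _; exists (t i).
Qed.

(** The root takes countably many values, and on each event where it is constant a single [g u] is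
    composed with [W]. *)
Lemma measurable_fun_root d (Om : measurableType d) (r : Om -> nat)
    (W : Om -> wgraph) (g : nat -> wgraph -> \bar R) :
  measurable_fun setT r -> measurable_fun setT W ->
  (forall u, measurable_fun setT (g u)) ->
  measurable_fun setT (fun w => g (r w) (W w)).
Proof.
move=> mr mW mg _ Y mY; rewrite setTI.
rewrite [X in measurable X](_ : _ =
    \bigcup_u (r @^-1` [set u] `&` (W @^-1` (g u @^-1` Y)))).
  apply: bigcup_measurable => u _; apply: measurableI.
    by rewrite -[X in measurable X]setTI; exact: mr.
  rewrite -[X in measurable X]setTI; apply: mW => //.
  by rewrite -[X in measurable X]setTI; exact: mg.
apply/seteqP; split=> [w /= gY|w [u _ [/= <-]]//].
by exists (r w).
Qed.

Lemma measurable_fun_root_series d (Om : measurableType d) (r : Om -> nat)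
    (W : Om -> wgraph) (g : nat -> nat -> wgraph -> \bar R) :
  measurable_fun setT r -> measurable_fun setT W ->
  (forall u v, measurable_fun setT (g u v)) ->
  (forall u v W, 0 <= g u v W) ->
  measurable_fun setT (fun w => \sum_(0 <= v <oo) g (r w) v (W w)).
Proof.
move=> mr mW mg g0.
apply: (measurable_fun_root (g := fun u W => \sum_(0 <= v <oo) g u v W)) => //.
by move=> u; apply: (ge0_emeasurable_sum (P := xpredT)).
Qed.

End Measurability.

(** * Expectation of a constant minus a nonnegative variable *)

Section Expectation.
Local Open Scope classical_set_scope.
Context d (Om : measurableType d) (R : realType).
Variable Pr : probability Om R.

(** The integral of [a] may be infinite: the positive part of [k - a] is at most [k], so no
    indeterminate difference arises and both sides are then [-oo]. *)
Lemma integral_cst_sub (k : R) (a : Om -> R) : (0 <= k)%R ->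
  measurable_fun setT a -> (forall w, 0 <= a w)%R ->
  \int[Pr]_w (k - a w)%:E = k%:E - \int[Pr]_w (a w)%:E.
Proof.
move=> k0 ma a0; set f := fun w => (k - a w)%:E.
have mf : measurable_fun setT f.
  apply/measurable_EFinP; apply: measurable_funB => //; exact: measurable_cst.
have mEa : measurable_fun setT (EFin \o a) by exact/measurable_EFinP.
(* Integrate the pointwise identity between nonnegative functions: positive part plus [a] equals
   negative part plus [k]. *)
have intD : \int[Pr]_w f^\+ w + \int[Pr]_w (a w)%:E =
            \int[Pr]_w f^\- w + k%:E.
  have <- : \int[Pr]_w (cst k%:E) w = k%:E.
    by rewrite integral_cst//= probability_setT mule1.
  rewrite -!ge0_integralD//.
  - apply: eq_integral => w _.
    rewrite funeposE funenegE /f /= -!EFin_max -!EFinD; congr EFin.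
    by have [?|?] := ltP (k - a w)%R 0%R; have [?|?] := ltP (- (k - a w))%R 0%R; lra.
  - exact: measurable_funeneg.
  - exact: measurable_funepos.
  - by move=> w _; rewrite lee_fin.
rewrite [LHS]integralE.
have : \int[Pr]_w f^\+ w <= k%:E.
  have <- : \int[Pr]_w (cst k%:E) w = k%:E.
    by rewrite integral_cst//= probability_setT mule1.
  apply: ge0_le_integral => //.
    exact: measurable_funepos.
  by move=> w _; rewrite funeposE ge_max/= !lee_fin k0 andbT gerBl.
move: intD.
have : 0 <= \int[Pr]_w f^\+ w by exact: integral_ge0.
have : 0 <= \int[Pr]_w f^\- w by exact: integral_ge0.
have : 0 <= \int[Pr]_w (a w)%:E.
  by apply: integral_ge0 => w _; rewrite lee_fin.
move: (\int[Pr]_w f^\+ w) (\int[Pr]_w f^\- w) (\int[Pr]_w (a w)%:E).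
move=> [p||] [q||] [A||]//= _ _ _.
by rewrite -!EFinD => -[pAqk] _; congr EFin; lra.
Qed.

End Expectation.

(** * Angle sums of a face as transported mass *)

Section Polyhedron.
Local Open Scope classical_set_scope.
Variable R : realType.

Lemma card_esum (T : choiceType) (A : set T) : finite_set A ->
  (ncard A)%:R%:E = \esum_(x in A) 1 :> \bar R.
Proof.
move=> fA; rewrite esum_fset// fsbig_finite// sumEFin.
by rewrite big_const_seq count_predT iter_addr_0.
Qed.

Lemma ncard_seq (T : choiceType) (s : seq T) : uniq s -> ncard [set` s] = size s.
Proof.
move=> us; apply/perm_size/uniq_perm => //.
move=> x; rewrite in_fset_set; last exact: finite_seq.
by apply/idP/idP => [/set_mem|xs]//; exact/mem_set.
Qed.

Variable P : ihp R.
Local Notation E := (share_edge P).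
Local Notation adjacent f := [set g | E f g].

Definition edge_angle_sum (f : 'rV[R]_3 * R) : R :=
  (\sum_(g \in adjacent f) dihedral f g)%R.

Definition vertex_angle_sum (f : 'rV[R]_3 * R) : R :=
  (\sum_(v \in ideal_vertices P f)
    (((deg_vertex P v)%:R - 2) * pi / (deg_vertex P v)%:R : R))%R.

Lemma share_edge_angle f g : E f g -> (0 < dihedral f g < pi)%R.
Proof. by have [bd [_ G]] := ihp_dual_angled P; exact: (iag_angle G). Qed.

Lemma finite_adjacent f : faces P f -> finite_set (adjacent f).
Proof.
have [bd [_ G]] := ihp_dual_angled P.
exact: (decomp_locally_finite (iag_decomposition G)).
Qed.

Lemma esum_adjacent f : faces P f ->
  \esum_(g in adjacent f) (dihedral f g)%:E = (edge_angle_sum f)%:E.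
Proof.
move=> /finite_adjacent fin; rewrite esum_fset ?fsumEFin// => g.
by rewrite inE lee_fin => /share_edge_angle/andP[/ltW].
Qed.

Lemma edge_angle_sum_ge0 f : faces P f -> (0 <= edge_angle_sum f)%R.
Proof.
move=> Pf; rewrite -lee_fin -esum_adjacent//; apply: esum_ge0 => g.
by rewrite lee_fin => /share_edge_angle/andP[/ltW].
Qed.

Lemma edge_angle_sum_le f : faces P f ->
  (edge_angle_sum f <= pi * (deg_face P f)%:R)%R.
Proof.
move=> Pf; rewrite -lee_fin -esum_adjacent// EFinM card_esum; last first.
  exact: finite_adjacent.
rewrite !esum_fset//; try exact: finite_adjacent; last first.
  by move=> g; rewrite inE lee_fin => /share_edge_angle/andP[/ltW].
rewrite !fsbig_finite; try exact: finite_adjacent.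
rewrite !sumEFin -EFinM lee_fin mulr_sumr.
rewrite big_seq [leRHS]big_seq; apply: ler_sum => g.
rewrite in_fset_set; last exact: finite_adjacent.
by rewrite inE mulr1 => /share_edge_angle/andP[_ /ltW].
Qed.

Lemma esum_transport_to f : faces P f ->
  \esum_(g in faces P) transport E (@dihedral R) g f = (edge_angle_sum f)%:E.
Proof.
move=> Pf; have [bd [_ G]] := ihp_dual_angled P.
by rewrite (transport_in G) esum_adjacent.
Qed.

Lemma esum_transport_from f : faces P f ->
  \esum_(g in faces P) transport E (@dihedral R) f g =
  (vertex_angle_sum f)%:E.
Proof.
move=> Pf; have [bd [bdP G]] := ihp_dual_angled P.
have D := iag_decomposition G.
rewrite (transport_out G).
have atE : [set v | ihp_vertices P v /\ f \in bd v] = ideal_vertices P f.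
  apply/seteqP; split=> v.
    by move=> [Pv /(bdP _ _ Pv)[]].
  by move=> fv; have [Pv _] := fv; split => //; apply/bdP.
(* The faces at [v] are the entries of a finite sequence, so [ncard] does not take its default value
   0. *)
have degE v : ihp_vertices P v -> deg_vertex P v = size (bd v).
  move=> Pv; have [uv _ _] := decomp_face D Pv.
  rewrite -ncard_seq//; congr ncard; apply/seteqP.
  by split=> g /=; move/(bdP _ _ Pv).
have fin : finite_set (ideal_vertices P f).
  by rewrite -atE; exact: finite_faces_at D _ Pf.
rewrite atE esum_fset//; last first.
  move=> v /set_mem[Pv _]; have [_ sv _] := decomp_face D Pv.
  rewrite lee_fin divr_ge0 ?mulr_ge0 ?pi_ge0// subr_ge0 ler_nat.
  exact: ltnW.
rewrite fsumEFin//; congr EFin; apply: eq_fsbigr => v /set_mem[Pv _].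
by rewrite degE.
Qed.

Lemma vertex_angle_sum_ge0 f : faces P f -> (0 <= vertex_angle_sum f)%R.
Proof.
move=> Pf; rewrite -lee_fin -esum_transport_from//; apply: esum_ge0 => g _.
by apply: transport_ge0 => x y /share_edge_angle/andP[/ltW].
Qed.

End Polyhedron.

(** * The labelled dual graph of a random polyhedron *)

Section RandomPolyhedron.
Local Open Scope classical_set_scope.
Context (R : realType) d (Om : measurableType d) (X : random_rooted_ihp R Om).
Local Notation P := (rih_poly X).
Local Notation W := (rih_dual X).
Local Notation root := (rih_root X).

Lemma faces_label w i : faces (P w) (rih_label X w i).
Proof. by have [lP _ _] := rih_labelP X w; exact: lP. Qed.

Lemma rih_dual_gt0 w i j :
  (0 < W w i j)%R = share_edge (P w) (rih_label X w i) (rih_label X w j).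
Proof.
rewrite /rih_dual; case: ifPn => [/share_edge_angle/andP[]//|_].
by rewrite ltxx.
Qed.

Lemma wtransport_label w i j : wtransport (W w) i j =
  transport (share_edge (P w)) (@dihedral R) (rih_label X w i) (rih_label X w j).
Proof.
have [_ l_inj l_surj] := rih_labelP X w.
apply: transport_map.
- by move=> k k'; apply: l_inj; rewrite inE.
- exact: rih_dual_gt0.
- by move=> k k'; rewrite rih_dual_gt0 /rih_dual => ->.
- by move=> x y /asboolP[Px _ _ _]; have [k _ <-] := l_surj x Px; exists k.
Qed.

Lemma sum_wtransport_from w :
  \sum_(0 <= v <oo) wtransport (W w) (root w) v =
  (vertex_angle_sum (P w) (root_face X w))%:E.
Proof.
rewrite nneseries_esumT; last by move=> v; exact: wtransport_ge0.
rewrite -esum_transport_from; last exact: faces_label.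
rewrite (reindex_esum _ _ _ _ (rih_labelP X w)).
by apply: eq_esum => v _; exact: wtransport_label.
Qed.

Lemma sum_wtransport_to w :
  \sum_(0 <= v <oo) wtransport (W w) v (root w) =
  (edge_angle_sum (P w) (root_face X w))%:E.
Proof.
rewrite nneseries_esumT; last by move=> v; exact: wtransport_ge0.
rewrite -esum_transport_to; last exact: faces_label.
rewrite (reindex_esum _ _ _ _ (rih_labelP X w)).
by apply: eq_esum => v _; exact: wtransport_label.
Qed.

(** Measurability in [w] is given for the weighted dual graph and the root label; the mass sent by
    the root is a series in these two. *)
Lemma measurable_vertex_angle_sum :
  measurable_fun setT (fun w => vertex_angle_sum (P w) (root_face X w)).
Proof.
apply/measurable_EFinP; rewrite /comp; under eq_fun do rewrite -sum_wtransport_from.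
apply: (measurable_fun_root_series (g := fun u v W => wtransport W u v)).
- exact: rih_root_measurable.
- exact: rih_dual_measurable.
- by move=> u v; exact: measurable_wtransport.
- by move=> *; exact: wtransport_ge0.
Qed.

Lemma measurable_edge_angle_sum :
  measurable_fun setT (fun w => edge_angle_sum (P w) (root_face X w)).
Proof.
apply/measurable_EFinP; rewrite /comp; under eq_fun do rewrite -sum_wtransport_to.
apply: (measurable_fun_root_series (g := fun u v W => wtransport W v u)).
- exact: rih_root_measurable.
- exact: rih_dual_measurable.
- by move=> u v; exact: measurable_wtransport.
- by move=> *; exact: wtransport_ge0.
Qed.

(** Reads the degree off the weights, to make it measurable. *)
Lemma sum_adjacent w :
  \sum_(0 <= v <oo) (if (0 < W w (root w) v)%R then 1 else 0) =
  (deg_face (P w) (root_face X w))%:R%:E :> \bar R.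
Proof.
rewrite nneseries_esumT; last by move=> v; case: ifP.
rewrite card_esum; last by apply: finite_adjacent; exact: faces_label.
have -> : [set g | share_edge (P w) (root_face X w) g] =
    faces (P w) `&` [set g | share_edge (P w) (root_face X w) g].
  by apply/esym/setIidr => g /asboolP[].
rewrite esum_mkcondr (reindex_esum _ _ _ _ (rih_labelP X w)).
by apply: eq_esum => v _; rewrite rih_dual_gt0 mem_setE.
Qed.

Lemma measurable_deg_face :
  measurable_fun setT (fun w => (deg_face (P w) (root_face X w))%:R : R).
Proof.
apply/measurable_EFinP; rewrite /comp; under eq_fun do rewrite -sum_adjacent.
apply: (measurable_fun_root_series
  (g := fun u v W => if (0 < W u v)%R then 1 else 0)).
- exact: rih_root_measurable.
- exact: rih_dual_measurable.
- move=> u v; apply: measurable_fun_ifT; try exact: measurable_cst.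
  apply: measurable_fun_ltr; first exact: measurable_cst.
  exact: measurable_weight.
- by move=> u v V; case: ifP.
Qed.

End RandomPolyhedron.

(** * Equality and finiteness of the two expectations *)

Theorem theorem1p8 (R : realType) (d : measure_display)
    (Om : measurableType d) (Pr : probability Om R)
    (X : random_rooted_ihp R Om) (hX : unimodular Pr X) :
  'E_Pr[fun w => T_ihp (rih_poly X w) (root_face X w)] =
  'E_Pr[fun w => kappa_ihp (rih_poly X w) (root_face X w)]
  /\
  ('E_Pr[fun w => (deg_face (rih_poly X w) (root_face X w))%:R%R] < +oo ->
   'E_Pr[fun w => T_ihp (rih_poly X w) (root_face X w)] \is a fin_num /\
   'E_Pr[fun w => kappa_ihp (rih_poly X w) (root_face X w)] \is a fin_num).
Proof.
have Tk : 'E_Pr[fun w => T_ihp (rih_poly X w) (root_face X w)] =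
    (2 * pi)%R%:E - \int[Pr]_w (edge_angle_sum (rih_poly X w) (root_face X w))%:E.
  rewrite unlock; apply: integral_cst_sub; first by rewrite mulr_ge0 ?pi_ge0.
    exact: measurable_edge_angle_sum.
  by move=> w; apply: edge_angle_sum_ge0; exact: faces_label.
have kk : 'E_Pr[fun w => kappa_ihp (rih_poly X w) (root_face X w)] =
    (2 * pi)%R%:E - \int[Pr]_w (vertex_angle_sum (rih_poly X w) (root_face X w))%:E.
  rewrite unlock; apply: integral_cst_sub; first by rewrite mulr_ge0 ?pi_ge0.
    exact: measurable_vertex_angle_sum.
  by move=> w; apply: vertex_angle_sum_ge0; exact: faces_label.
(* Unimodularity for [wtransport]: the root sends its vertex sum and receives its edge sum. *)
have mtp : \int[Pr]_w (vertex_angle_sum (rih_poly X w) (root_face X w))%:E =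
    \int[Pr]_w (edge_angle_sum (rih_poly X w) (root_face X w))%:E.
  under eq_integral do rewrite -sum_wtransport_from.
  under [RHS]eq_integral do rewrite -sum_wtransport_to.
  apply: (hX (@wtransport R)).
  - exact: wtransport_ge0.
  - exact: measurable_wtransport.
  - exact: iso_invariant_wtransport.
rewrite Tk kk mtp; split=> //; rewrite unlock => degfin.
(* Both expectations are now [2 * pi] minus this integral, which is at most [pi] times the mean
   degree since every angle is below [pi]. *)
suff afin : \int[Pr]_w (edge_angle_sum (rih_poly X w) (root_face X w))%:E
    \is a fin_num by rewrite fin_numB afin.
have a0 w : (0 <= edge_angle_sum (rih_poly X w) (root_face X w))%R.
  by apply: edge_angle_sum_ge0; exact: faces_label.
rewrite ge0_fin_numE; last by apply: integral_ge0 => w _; rewrite lee_fin.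
apply: le_lt_trans (_ : _ <= pi%:E *
  \int[Pr]_w (deg_face (rih_poly X w) (root_face X w))%:R%:E) _; last first.
  by rewrite lte_mul_pinfty// ?lee_fin ?pi_ge0.
rewrite -ge0_integralZl_EFin//; last by rewrite pi_ge0.
- apply: ge0_le_integral => //.
  + by move=> w _; rewrite lee_fin.
  + by apply/measurable_EFinP; exact: measurable_edge_angle_sum.
  + apply: measurable_funeM; apply/measurable_EFinP; exact: measurable_deg_face.
  + move=> w _; rewrite -EFinM lee_fin; apply: edge_angle_sum_le.
    exact: faces_label.
- by apply/measurable_EFinP; exact: measurable_deg_face.
Qed.
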